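(* Let $\mathbf H$ be a real Hilbert space and let $\mathbf S,\mathbf A,\mathbf C,\mathbf M,\beta,\rho,\hat\rho,\zeta,\tau$ satisfy the standing assumptions (a)–(e) listed in the context, with $\operatorname{zer}(\mathbf A+\mathbf C)\neq\varnothing$. Let $\theta\in\,]0,2[$, let $(x_0,u_0)\in\mathbf H^2$, and let $(p_{n},u_{n},x_{n})_{n\ge 1}$ be generated by $$(\forall n\in\mathbb N)\quad\begin{cases}p_{n+1}=(\mathbf M+\mathbf A)^{-1}(\mathbf Mx_n-\mathbf Cx_n+u_n/\tau)\\ u_{n+1}=(\tau\mathbf M-\mathbf S)p_{n+1}-(\tau\mathbf M-\mathbf S)x_n\\ x_{n+1}=(1-\theta)x_n+\theta p_{n+1}.\end{cases}$$ Let $\zeta_{\mathbf M}\in\,]0,+\infty[$ be the Lipschitz modulus of $\mathbf M$ with respect to $\mathbf S$, let $\eta=1$ if $\theta\in[1,2[$ and $\mathbf S-\tau\mathbf M$ is monotone, and $\eta=1+|1-\theta|$ otherwise, and suppose that $$\lambda:=2-\theta-2\eta\zeta-\frac{(\tau+2\hat\rho)^2}{2\tau\big(\beta+\hat\rho(1+\tau^{-1}\zeta)\big)}+2\hat\rho\tau\Big(\big(\tau^{-1}\zeta+\zeta_{\mathbf M}\big)^2+4\tau^{-1}\zeta\Big)>0.$$ Then the following hold. (i) $(x_n)_{n\in\mathbb N}$ converges weakly to a point of $\operatorname{zer}(\mathbf A+\mathbf C)$. (ii) If, in addition, $\mathbf A$ is $(\mu\mathbf S,\rho\mathbf S^{-1})$-semimonotone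 on $\mathbb S$ for some $\mu\in\,]0,+\infty[$, then $(x_n)_{n\in\mathbb N}$ converges R-linearly to the unique point of $\operatorname{zer}(\mathbf A+\mathbf C)$.
   Context: For a set-valued operator $\mathbf A$, $\operatorname{zer}\mathbf A=\{x: 0\in \mathbf Ax\}$ and $\operatorname{gra}\mathbf A=\{(x,u):u\in \mathbf Ax\}$. For a bounded self-adjoint strongly monotone linear operator $\mathbf S$ (i.e. $\langle \mathbf Sx,x\rangle\ge m\|x\|^2$ for some $m>0$), $\|x\|_{\mathbf S}^2=\langle x,\mathbf Sx\rangle$. An operator $R:\mathbf H\to\mathbf H$ is $\beta$-cocoercive with respect to $\mathbf S$ if $\langle x-y,Rx-Ry\rangle\ge\beta\|Rx-Ry\|_{\mathbf S^{-1}}^2$ for all $x,y$; it is $\zeta$-Lipschitzian with respect to $\mathbf S$ if $\|Rx-Ry\|_{\mathbf S^{-1}}\le\zeta\|x-y\|_{\mathbf S}$ for all $x,y$; its Lipschitz modulus with respect to $\mathbf S$ is the smallest such $\zeta$. For bounded self-adjoint linear operators $M,N$ and a set $\mathcal S\subset\mathbf H^2$, a set-valued operator $\mathbf A$ is $(M,N)$-semimonotone on $\mathcal S$ if for all $(y,v)\in\mathcal S$ and $(x,u)\in\operatorname{gra}\mathbf A$, $\langle x-y,u-v\rangle\ge\langle x-y,M(x-y)\rangle+\langle u-v,N(u-v)\rangle$. It is $N$-comonotone on $\mathcal S$ if it is $(0,N)$-semimonotone on $\mathcal S$. A graph is sequentially weak-strong closed if $(x_n,u_n)$ in the graph, $x_n\rightharpoonup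 x$ and $u_n\to u$ imply that $(x,u)$ is in the graph. Standing assumptions. $\mathbf S:\mathbf H\to\mathbf H$ is bounded, linear, self-adjoint and strongly monotone; $\mathbf A:\mathbf H\to2^{\mathbf H}$ is set-valued; $\mathbf M:\mathbf H\to\mathbf H$ is single-valued; and: (a) $\mathbf C:\mathbf H\to\mathbf H$ is $\beta$-cocoercive with respect to $\mathbf S$ for some $\beta>0$; (b) $(\mathbf M+\mathbf A)^{-1}$ is single-valued and has full domain; (c) $\operatorname{gra}(\mathbf A+\mathbf C)$ is sequentially weak-strong closed; (d) $\mathbf A$ is $\rho\mathbf S^{-1}$-comonotone on $\mathbb S=\{(x,-\mathbf Cx): x\in\operatorname{zer}(\mathbf A+\mathbf C)\}$ for some $\rho\in\,]-\beta,+\infty[$; (e) with $\hat\rho=\min\{\rho,0\}$, there are $\zeta\in[0,1/2[$ and $\tau\in\,]\underline\tau_\zeta,+\infty[$, where $\underline\tau_\zeta=-\zeta\hat\rho/(\beta+\hat\rho)$, such that $\tau\mathbf M-\mathbf S$ is $\zeta$-Lipschitzian with respect to $\mathbf S$. R-linear convergence of $(x_n)$ to $x$ means that $\|x_n-x\|\le \varepsilon_n$ for some nonnegative sequence converging Q-linearly to $0$ (equivalently $\|x_n-x\|\le c\,r^n$ with $c\geq 0$, $r\in\,]0,1[$). *)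

(* Defs.v *)
From HB Require Import structures.
From mathcomp Require Import all_boot all_order all_algebra.
From mathcomp Require Import sesquilinear.
From mathcomp Require Import all_classical all_reals all_analysis.

Set Implicit Arguments.
Unset Strict Implicit.
Unset Printing Implicit Defensive.

Import Order.TTheory GRing.Theory Num.Theory.
Import numFieldNormedType.Exports.

Local Open Scope classical_set_scope.
Local Open Scope ring_scope.

(* `H` with `dot` is a real Hilbert space when the norm of the Banach space `H`
   is the one induced by the inner product `dot`. *)
Definition hilbert_norm (R : realType) (H : completeNormedModType R)
    (dot : {dot H for idfun}) : Prop :=
  forall x : H, `|x| = Num.sqrt (dot x x).

Section SetValued.
Context {V : zmodType}.

(* A set-valued operator `A : V -> set V` has `u \in A x` written `A x u`. *)

Definition gra (A : V -> set V) : set (V * V) := [set xu | A xu.1 xu.2].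

Definition zer (A : V -> set V) : set V := [set x | A x 0].

Definition single (T : V -> V) : V -> set V := fun x => [set T x].

Definition op_add (A B : V -> set V) : V -> set V :=
  fun x => [set w | exists u v, A x u /\ B x v /\ w = u + v].

Definition op_inv (A : V -> set V) : V -> set V := fun y => [set x | A x y].

Definition single_valued_full_domain (A : V -> set V) : Prop :=
  forall x, exists u, A x = [set u].

(* The inverse of a map; only ever used on bijections, `0` being a junk value
   outside the range. *)
Definition inv_map (T : V -> V) : V -> V := fun y => xget 0 [set x | T x = y].

End SetValued.

Section Hilbert.
Context {R : realType} {H : completeNormedModType R}.
Variable dot : {dot H for idfun}.

Definition bounded_op (T : H -> H) : Prop :=
  exists k : R, forall x, `|T x| <= k * `|x|.

Definition self_adjoint (T : H -> H) : Prop :=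
  forall x y, dot (T x) y = dot x (T y).

(* Tested against 0 only, so this is strong monotonicity for linear maps. *)
Definition strongly_monotone (T : H -> H) : Prop :=
  exists2 m : R, 0 < m & forall x, m * `|x| ^+ 2 <= dot (T x) x.

Definition monotone (T : H -> H) : Prop :=
  forall x y, 0 <= dot (x - y) (T x - T y).

Definition norm_op (T : H -> H) (x : H) : R := Num.sqrt (dot x (T x)).

Definition cocoercive (S : H -> H) (beta : R) (T : H -> H) : Prop :=
  forall x y,
    beta * norm_op (inv_map S) (T x - T y) ^+ 2 <= dot (x - y) (T x - T y).

Definition lipschitzian (S : H -> H) (zeta : R) (T : H -> H) : Prop :=
  forall x y, norm_op (inv_map S) (T x - T y) <= zeta * norm_op S (x - y).

(* The smallest Lipschitz constant; `0 <= z` only matters on the zero space,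
   where every real number would otherwise be a constant. *)
Definition lipschitz_modulus (S T : H -> H) (zeta : R) : Prop :=
  let L := [set z : R | 0 <= z /\ lipschitzian S z T] in
  L zeta /\ lbound L zeta.

Definition semimonotone (M N : H -> H) (D : set (H * H)) (A : H -> set H)
    : Prop :=
  forall yv xu, D yv -> gra A xu ->
    let d := xu.1 - yv.1 in
    let e := xu.2 - yv.2 in
    dot d (M d) + dot e (N e) <= dot d e.

Definition comonotone (N : H -> H) (D : set (H * H)) (A : H -> set H) : Prop :=
  semimonotone (fun=> 0) N D A.

Definition weak_cvg (x : nat -> H) (l : H) : Prop :=
  forall y, (fun n => dot (x n) y) @ \oo --> dot l y.

Definition seq_weak_strong_closed (G : set (H * H)) : Prop :=
  forall (x u : nat -> H) (x' u' : H), (forall n, G (x n, u n)) ->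
    weak_cvg x x' -> u @ \oo --> u' -> G (x', u').

Definition Qlinear_cvg0 (e : nat -> R) : Prop :=
  exists2 r : R, 0 < r < 1 & forall n, `|e n.+1| <= r * `|e n|.

Definition Rlinear_cvg (x : nat -> H) (l : H) : Prop :=
  exists e : nat -> R, [/\ forall n, 0 <= e n, Qlinear_cvg0 e &
    forall n, `|x n - l| <= e n].

Definition relax_eta (S M : H -> H) (tau theta : R) : R :=
  if `[< 1 <= theta < 2 /\ monotone (fun x => S x - tau *: M x) >]
  then 1 else 1 + `|1 - theta|.

End Hilbert.

(* Main.v *)
Require Import Defs.
From mathcomp Require Import all_boot all_order all_algebra.
From mathcomp Require Import sesquilinear.
From mathcomp Require Import all_classical all_reals all_analysis.
From mathcomp Require Import ring lra.
Import Order.TTheory GRing.Theory Num.Theory.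
Import numFieldNormedType.Exports.
Local Open Scope classical_set_scope.
Local Open Scope ring_scope.

(** Work in the inner product [<x, y>_S = <x, S y>] with [T = S^-1]. For a zero
    [z] put [w_n = x_n - z], [d_n = x_n - p_(n+1)], [v_n = T u_n] and
    [h = min(rho, 0)]. Testing the inclusion defining [p_(n+1)] against [z] and
    adding the cocoercivity of [C] gives, after Young inequalities,
      [V_(n+1) + theta lambda |d_n|^2 <= V_n]   for [n >= 1], where
      [V_n = |w_n|^2 + 2 theta <w_n, v_n> + theta kappa |d_(n-1)|^2],
      [kappa = zeta - 2 (h / tau) zeta (tau zeta_M + zeta) - 4 h zeta],
    and [V_n >= (1 - theta zeta) |w_n|^2]. Hence [d_n -> 0] and every weak cluster
    point is a zero. Since [V_n(z) - V_n(z')] converges for any two zeros, [<x_n,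
    z - z'>_S] converges, and Opial's argument gives weak convergence.
    With strong monotonicity the decrease gains [2 theta tau mu |p_(n+1) - z|^2];
    as [V_(n+1)] is itself at most a multiple of [|p_(n+1) - z|^2 + |d_n|^2],
    [V_n] decays geometrically. *)

Set Implicit Arguments.
Unset Strict Implicit.
Unset Printing Implicit Defensive.

(** * Positive semidefinite forms and the one-step energy estimate *)

Section PsdForm.
Context {R : realFieldType} {V : lmodType R} {b : V -> V -> R}.
Hypothesis bC : forall x y, b x y = b y x.
Hypothesis bP : forall a x y z, b (a *: x + y) z = a * b x z + b y z.
Hypothesis b_ge0 : forall x, 0 <= b x x.

Lemma psdDl x y z : b (x + y) z = b x z + b y z.
Proof. by rewrite -[x]scale1r bP mul1r scale1r. Qed.

Lemma psd0l z : b 0 z = 0.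
Proof. by apply: (addrI (b 0 z)); rewrite -psdDl !addr0. Qed.

Lemma psdZl a x z : b (a *: x) z = a * b x z.
Proof. by rewrite -[a *: x]addr0 bP psd0l addr0. Qed.

Lemma psdNl x z : b (- x) z = - b x z.
Proof. by rewrite -scaleN1r psdZl mulN1r. Qed.

Lemma psdDr x y z : b z (x + y) = b z x + b z y.
Proof. by rewrite !(bC z) psdDl. Qed.

Lemma psdZr a x z : b z (a *: x) = a * b z x.
Proof. by rewrite !(bC z) psdZl. Qed.

Lemma psdNr x z : b z (- x) = - b z x.
Proof. by rewrite !(bC z) psdNl. Qed.

Definition psdE := (psdDl, psdDr, psdNl, psdNr, psdZl, psdZr).

Lemma psd_cauchy_schwarz x y : b x y ^+ 2 <= b x x * b y y.
Proof.
have [y0|yN0] := eqVneq (b y y) 0.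
  have [->|xyN0] := eqVneq (b x y) 0; first by rewrite expr0n y0 mulr0.
  (* The form may be degenerate: if [b y y = 0] and [b x y != 0], this scalar makes the quadratic
     equal to -1. *)
  have := b_ge0 (x - ((b x x + 1) / (2 * b x y)) *: y).
  rewrite !psdE (bC y x) y0.
  suff -> : b x x - (b x x + 1) / (2 * b x y) * b x y +
    (- ((b x x + 1) / (2 * b x y) * b x y) -
     - ((b x x + 1) / (2 * b x y) * ((b x x + 1) / (2 * b x y) * 0))) = -1.
    by lra.
  by field.
have y_gt0 : 0 < b y y by rewrite lt_def yN0 b_ge0.
have := b_ge0 (b y y *: x - b x y *: y).
rewrite !psdE (bC y x) => h.
rewrite -subr_ge0 -(pmulr_rge0 _ y_gt0); lra.
Qed.

Lemma psd_young a c x y X Y : 0 <= a -> 0 <= c -> 0 <= X -> 0 <= Y ->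
  b x x <= a ^+ 2 * X -> b y y <= c ^+ 2 * Y ->
  2 * b x y <= a * c * (X + Y).
Proof.
move=> a0 c0 X0 Y0 hx hy.
have [xy0|xy0] := leP (b x y) 0.
  by have := mulr_ge0 (mulr_ge0 a0 c0) (addr_ge0 X0 Y0); lra.
rewrite -ler_sqr ?nnegrE ?mulr_ge0 ?addr_ge0 ?(ltW xy0)//.
have h1 := psd_cauchy_schwarz x y.
have h2 := ler_pM (b_ge0 x) (b_ge0 y) hx hy.
have h3 : 0 <= (a * c) ^+ 2 * (X - Y) ^+ 2 by rewrite mulr_ge0 ?sqr_ge0.
by rewrite !exprMn in h3 *; lra.
Qed.

(* [k] stands for [- min(rho, 0) / tau] and [D] for the squared norm of the
   previous [d]; the substitution removes every division by [tau]. *)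
Lemma lyapunov_step (w d c v u : V) (tau k beta zeta zetaM theta mu eta B G D kap lam : R) :
  0 < tau -> 0 <= k -> 0 <= zeta -> 0 <= zetaM -> 0 <= theta -> 0 <= D ->
  B = beta - k * tau - k * zeta -> 0 < B ->
  2 * B * G = tau * (1 - 2 * k) ^+ 2 ->
  b v v <= zeta ^+ 2 * b d d -> b u u <= zeta ^+ 2 * D ->
  b (d - v) (d - v) <= (tau * zetaM) ^+ 2 * b d d ->
  (1 - theta) * b d v <= (eta - 1) * zeta * b d d ->
  beta * b c c <= b w c ->
  tau * mu * b (w - d) (w - d)
    - k * b (d - v + u - tau *: c) (d - v + u - tau *: c)
    <= b (w - d) (d - v + u - tau *: c) ->
  kap = zeta + 2 * k * zeta * (tau * zetaM + zeta) + 4 * k * tau * zeta ->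
  lam = 2 - theta - 2 * eta * zeta - G
    - 2 * k * ((zeta + tau * zetaM) ^+ 2 + 4 * tau * zeta) ->
  b (w - theta *: d) (w - theta *: d) + 2 * theta * b (w - theta *: d) v
    + theta * kap * b d d
    + theta * lam * b d d + 2 * theta * tau * mu * b (w - d) (w - d)
  <= b w w + 2 * theta * b w u + theta * kap * D.
Proof.
move=> t0 k0 z0 zM0 th0 D0 BE B0 GE hv hu he heta hc hm -> ->.
(* [a1] treats the inertial term; [a2] to [a4] treat cross terms in the expansion of
   [k |d - v + u - tau c|^2]. The [D] parts add up to [kap]. *)
have tzM0 : 0 <= tau * zetaM by rewrite mulr_ge0// ltW.
have a1 : 2 * b (- u) d <= zeta * 1 * (D + b d d).
  by apply: psd_young; rewrite // ?ler01 ?expr1n ?mul1r// !psdE opprK.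
have a2 : 2 * b (d - v) u <= tau * zetaM * zeta * (b d d + D).
  exact: psd_young.
have a3 : 2 * b (2 *: v) c <= zeta * 1 * (4 * b d d + b c c).
  by apply: psd_young; rewrite // ?ler01 ?expr1n ?mul1r ?mulr_ge0// !psdE; lra.
have a4 : 2 * b (- (2 *: u)) c <= zeta * 1 * (4 * D + b c c).
  by apply: psd_young; rewrite // ?ler01 ?expr1n ?mul1r ?mulr_ge0// !psdE; lra.
(* [B] is the cocoercivity left after the terms above, and [G] is the price of completing the
   square: [2 B] times the gap equals [tau |2 B c - (1 - 2 k) d|^2]. *)
have a5 : 2 * tau * (1 - 2 * k) * b d c <= 2 * tau * B * b c c + G * b d d.
  rewrite -subr_ge0 -(pmulr_rge0 _ (mulr_gt0 (ltr0Sn R 1) B0)).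
  have -> : 2 * B * (2 * tau * B * b c c + G * b d d
     - 2 * tau * (1 - 2 * k) * b d c) =
     tau * (4 * B ^+ 2 * b c c - 4 * B * (1 - 2 * k) * b d c
       + (1 - 2 * k) ^+ 2 * b d d).
    by rewrite mulrBr mulrDr [2 * B * (G * _)]mulrA GE; ring.
  have := b_ge0 ((2 * B) *: c - (1 - 2 * k) *: d).
  rewrite !psdE (bC c d) => h; apply: mulr_ge0; first exact: ltW.
  by lra.
have a2' := ler_wpM2l k0 a2.
have a3' := ler_wpM2l (mulr_ge0 k0 (ltW t0)) a3.
have a4' := ler_wpM2l (mulr_ge0 k0 (ltW t0)) a4.
have he' := ler_wpM2l k0 he.
have hu' := ler_wpM2l k0 hu.
have hc' := ler_wpM2l (ltW t0) hc.
rewrite -subr_ge0; set E := (X in 0 <= X).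
have -> : E = theta * (2 * b w d - theta * b d d - 2 * b w v
    + 2 * theta * b d v + 2 * b w u - 2 * tau * mu * b (w - d) (w - d)
    - (zeta + 2 * k * zeta * (tau * zetaM + zeta) + 4 * k * tau * zeta)
        * (b d d - D)
    - (2 - theta - 2 * eta * zeta - G
       - 2 * k * ((zeta + tau * zetaM) ^+ 2 + 4 * tau * zeta)) * b d d).
  by rewrite /E !psdE (bC d w); ring.
apply: mulr_ge0 => //; move: a1 a2' a3' a4' he' hu' hc' a5 hm heta; rewrite BE !psdE.
rewrite !(bC _ w) !(bC _ d) ?(bC c) ?(bC u).
move: (b w w) (b w d) (b w c) (b w v) (b w u) (b d d) (b d c) (b d v) (b d u)
  (b c c) (b v c) (b u c) => *.
lra.
Qed.

End PsdForm.

(** * Extraction of subsequences *)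

(** Compactness of [[-K, K]] yields a cluster point of the image of [U]; for an ultrafilter a
    cluster point is a limit, since a set or its complement belongs to it. *)
Lemma ultrafilter_bounded_cvg {R : realType} (U : set_system nat)
    (UU : UltraFilter U) (a : nat -> R) (K : R) :
  (forall n, `|a n| <= K) -> exists l : R, a n @[n --> U] --> l.
Proof.
move=> aK.
have [|l [_ cl]] := @segment_compact R (- K) K (fmap a U) _ _.
  apply: (@filterS _ U _ setT) filterT => n _.
  by rewrite /preimage/= in_itv/= -ler_norml.
exists l => N Nl; rewrite /nbhs/=.
have [//|UN] := in_ultra_setVsetC (a @^-1` N) UU.
have [//|y [yNN yN]] := cl (~` N) N _ Nl.
by [].
Qed.

(* All limits are first taken along one ultrafilter; a single subsequence
   attaining them is then chosen greedily. *)
Lemma diagonal_extraction {R : realType} (a : nat -> nat -> R) (K : nat -> R) :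
  (forall n m, `|a n m| <= K m) ->
  exists f : nat -> nat, (forall n, (n <= f n)%N) /\
    forall m, cvgn (fun n => a (f n) m).
Proof.
move=> aK.
have [U [UU oU]] := @ultraFilterLemma nat \oo _.
have /choice[l al] m := @ultrafilter_bounded_cvg R U UU (a^~ m) (K m) (aK^~ m).
have near_le k e : 0 < e ->
    U [set n | forall m, (m <= k)%N -> `|l m - a n m| < e].
  move=> e0; elim: k => [|k IH].
    have /cvgrPdist_lt/(_ e e0) := al 0%N.
    by apply: filterS => n h [|//].
  have /cvgrPdist_lt/(_ e e0) := al k.+1.
  apply: filterS2 IH => n h1 h2 m; rewrite leq_eqVlt => /predU1P[->//|].
  exact: h1.
have /choice[f fP] k : exists n, (k <= n)%N /\
    forall m, (m <= k)%N -> `|l m - a n m| < k.+1%:R^-1.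
  have h1 := near_le k k.+1%:R^-1; rewrite invr_gt0 ltr0Sn in h1.
  (* [U] refines [\oo] and so contains all tails, which allows an index at least [k]. *)
  have h2 : U [set n | (k <= n)%N] by apply: oU; exists k.
  have [n [h3 h4]] := filter_ex (filterI (h1 isT) h2).
  by exists n.
exists f; split=> [n|m]; first by have [] := fP n.
apply/cvg_ex; exists (l m); apply/cvgrPdist_lt => e e0.
have /cvgrPdist_lt/(_ e e0)[N _ NP] := @cvg_harmonic R.
exists (maxn N m) => // n /=; rewrite geq_max => /andP[Nn mn].
have [_ /(_ _ mn)/lt_trans] := fP n; apply.
by have := NP n Nn; rewrite /= sub0r normrN ger0_norm// harmonic_ge0.
Qed.

(** Subsequences are encoded by index maps with [n <= f n], not necessarily increasing; this already
    sends [\oo] to [\oo]. *)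
Lemma cvg_subseq_ge {T : topologicalType} (u : nat -> T) (F : set_system T)
    (f : nat -> nat) :
  (forall n, (n <= f n)%N) -> u @ \oo --> F -> (u \o f) @ \oo --> F.
Proof.
move=> fn; apply: cvg_comp.
by apply/cvgnyPge => N; exists N => // n /= /leq_trans; apply.
Qed.

(** * Inner product, norm and weak convergence *)

Section RealHilbert.
Context {R : realType} {H : completeNormedModType R}.
Variable dot : {dot H for idfun}.
Hypothesis Hnorm : hilbert_norm dot.

Lemma dotC x y : dot x y = dot y x.
Proof. by rewrite hermC expr0 mul1r. Qed.

Lemma dotPl a x y z : dot (a *: x + y) z = a * dot x z + dot y z.
Proof. by rewrite linearPl. Qed.

Lemma dot_ge0 x : 0 <= dot x x.
Proof.
have [->|x0] := eqVneq x 0; first by rewrite linear0l.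
exact/ltW/neq0_dnorm_gt0.
Qed.

Definition dotE := (psdE dotC dotPl).

Lemma dot0l y : dot 0 y = 0. Proof. by rewrite linear0l. Qed.

Lemma dot0r y : dot y 0 = 0. Proof. by rewrite dotC dot0l. Qed.

Lemma sqr_norm x : `|x| ^+ 2 = dot x x.
Proof. by rewrite Hnorm sqr_sqrtr// dot_ge0. Qed.

Lemma cauchy_schwarz x y : `|dot x y| <= `|x| * `|y|.
Proof.
rewrite -ler_sqr ?nnegrE ?mulr_ge0// exprMn !sqr_norm real_normK ?num_real//.
exact: (psd_cauchy_schwarz dotC dotPl dot_ge0).
Qed.

Lemma dot_eq0 x : dot x x = 0 -> x = 0.
Proof. by rewrite -sqr_norm => /eqP; rewrite sqrf_eq0 normr_eq0 => /eqP. Qed.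

Lemma cvg_dotl (x : nat -> H) l : x @ \oo --> l -> weak_cvg dot x l.
Proof.
move=> xl y; apply/cvgrPdist_le => e e0.
have d0 : 0 < e / (`|y| + 1) by rewrite divr_gt0// ltr_wpDl.
move/cvgrPdist_le/(_ _ d0): xl; apply: filterS => n xn.
have -> : dot l y - dot (x n) y = dot (l - x n) y by rewrite !dotE.
apply: (le_trans (cauchy_schwarz _ _)).
apply: (le_trans (ler_wpM2r (normr_ge0 y) xn)).
by rewrite -mulrA ler_piMr ?(ltW e0)// ler_pdivrMl ?mulr1 ?lerDl ?ltr_wpDl.
Qed.

Definition linear_subspace (F : set H) : Prop :=
  F 0 /\ forall a x y, F x -> F y -> F (a *: x + y).

Definition closure_by_norm (F : set H) (x : H) : Prop :=
  forall e, 0 < e -> exists2 y, F y & `|x - y| < e.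


(** * Riesz representation by minimizing a quadratic functional *)

Section MinimizationOverSubspace.
Variables (S : {linear H -> H}) (F : set H) (L : H -> R) (K : R).
Hypothesis S_self_adjoint : self_adjoint dot S.
Hypothesis S_strongly_monotone : strongly_monotone dot S.
Hypothesis F_subspace : linear_subspace F.
Hypothesis L_linear : forall a x y, F x -> F y -> L (a *: x + y) = a * L x + L y.
Hypothesis L_bounded : forall x, F x -> L x <= K * `|x|.

(* [g] is a limit of a minimizing sequence over [F] of
   [y |-> dot (S y) y - 2 * L y]. *)
Lemma riesz_subspace :
  exists g, closure_by_norm F g /\ forall y, F y -> dot (S g) y = L y.
Proof.
have [F0 FP] := F_subspace.
have [m m0 mS] := S_strongly_monotone.
pose J y := dot (S y) y - 2 * L y.
have hasJ : has_inf (J @` F).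
  split; first by exists (J 0); exists 0.
  (* The minimum of [m t^2 - 2 K t] over real [t], evaluated at [t = |y|] below. *)
  exists (- (K ^+ 2 / m)) => _ [y Fy <-].
  have h1 := mS y; have h2 := L_bounded Fy.
  have h3 : 0 <= m^-1 * (m * `|y| - K) ^+ 2 by rewrite mulr_ge0 ?sqr_ge0 ?invr_ge0 ?ltW.
  have h4 : m^-1 * (m * `|y| - K) ^+ 2 = m * `|y| ^+ 2 - 2 * (K * `|y|) + K ^+ 2 / m.
    by field; rewrite gt_eqF.
  by rewrite /J; lra.
set j := inf (J @` F).
have jJ y : F y -> j <= J y by move=> Fy; apply: ge_inf; [exact: hasJ.2|exists y].
have /choice[f fP] n : exists y, F y /\ J y < j + n.+1%:R^-1.
  have n0 : 0 < n.+1%:R^-1 :> R by rewrite invr_gt0 ltr0Sn.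
  by have [_ [y Fy <-] yn] := inf_adherent n0 hasJ; exists y.
(* Half the derivative of [J] at [f n] in the direction [y]. Near-minimality along the line
   [f n + t y] gives a nonnegative quadratic in [t], whose discriminant bound is [rsmall]. *)
pose r n y := dot (S (f n)) y - L y.
have SC x y : dot (S x) y = dot (S y) x by rewrite S_self_adjoint dotC.
have rsmall n y : F y -> r n y ^+ 2 <= n.+1%:R^-1 * dot (S y) y.
  move=> Fy; have [Ff fj] := fP n.
  have pol t : 0 <= t ^+ 2 * dot (S y) y + 2 * t * r n y + n.+1%:R^-1.
    have := jJ _ (FP t y (f n) Fy Ff).
    rewrite /J L_linear// linearP !dotE (SC y (f n)) => h; move: fj.
    by rewrite /J /r; move: (n.+1%:R^-1) => en; lra.
  have q0 : 0 <= dot (S y) y by apply: (le_trans _ (mS y)); rewrite mulr_ge0 ?(ltW m0) ?sqr_ge0.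
  have [q1|qN] := eqVneq (dot (S y) y) 0.
    have := mS y; rewrite q1 pmulr_rle0// => h.
    have y0 : y = 0.
      by apply/eqP; rewrite -normr_eq0 -sqrf_eq0 eq_le h sqr_ge0.
    have L0 : L 0 = 0 by have := L_linear 1 F0 F0; rewrite scaler0 addr0 mul1r; lra.
    by rewrite /r y0 dot0r L0 subrr expr0n/= mulr0.
  have q2 : 0 < dot (S y) y by rewrite lt_def qN.
  have := pol (- (r n y / dot (S y) y)).
  have -> : (- (r n y / dot (S y) y)) ^+ 2 * dot (S y) y +
     2 * - (r n y / dot (S y) y) * r n y + n.+1%:R^-1 =
     (n.+1%:R^-1 * dot (S y) y - r n y ^+ 2) / dot (S y) y.
    by field; rewrite qN/= gt_eqF.
  by rewrite pmulr_lge0 ?invr_gt0// subr_ge0.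
(* In the direction [f n - f k], the two derivatives differ by exactly [q], so [rsmall] bounds
   [q ^+ 2] by a small multiple of [q]. *)
have fdist n k : m * `|f n - f k| ^+ 2 <= 2 * (n.+1%:R^-1 + k.+1%:R^-1).
  have Fnk : F (f n - f k).
    by have := FP (-1) _ _ (fP k).1 (fP n).1; rewrite scaleN1r addrC.
  apply: (le_trans (mS _)); set q := dot _ _.
  have [q1|q1] := leP q 0.
    by apply: (le_trans q1); rewrite mulr_ge0// addr_ge0 ?invr_ge0.
  have h1 := rsmall n _ Fnk; have h2 := rsmall k _ Fnk.
  have h3 : q = r n (f n - f k) - r k (f n - f k).
    by rewrite /q /r (linearB S) !dotE; ring.
  have h4 := sqr_ge0 (r n (f n - f k) + r k (f n - f k)).
  rewrite -/q in h1 h2; rewrite -(ler_pM2r q1) -expr2 {1}h3.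
  move: h1 h2 h4; move: (n.+1%:R^-1) (k.+1%:R^-1) => en ek; lra.
have : cauchy (f @ \oo).
  apply: cauchy_exP => e e0.
  have me : 0 < m * e ^+ 2 / 4 by rewrite !mulr_gt0 ?exprn_gt0 ?invr_gt0.
  have /cvgrPdist_lt/(_ _ me)[N _ NP] := @cvg_harmonic R.
  exists (f N); exists N => // n /= Nn; rewrite -ball_normE/=.
  have h1 := NP n Nn; have h2 := NP N (leqnn N); have h3 := fdist N n.
  rewrite /= !sub0r !normrN !ger0_norm ?harmonic_ge0// in h1 h2.
  rewrite -ltr_sqr ?nnegrE ?(ltW e0)// -(ltr_pM2l m0); rewrite /harmonic/= in h1 h2.
  by move: h1 h2 h3; move: (n.+1%:R^-1) (N.+1%:R^-1) => en ek; lra.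
move=> /cauchy_cvg/cvg_ex[g fg]; exists g; split.
  move=> e e0; have /cvgrPdist_lt/(_ _ e0)[N _ NP] := fg.
  by exists (f N); [exact: (fP N).1|exact: (NP N (leqnn N))].
move=> y Fy; rewrite S_self_adjoint.
have h1 : weak_cvg dot f g by exact: cvg_dotl.
suff h2 : dot (f n) (S y) @[n --> \oo] --> L y.
  exact: (cvg_unique (@norm_hausdorff _ _) (h1 (S y)) h2).
apply/cvgrPdist_le => e e0.
have q0 : 0 <= dot (S y) y by apply: (le_trans _ (mS y)); rewrite mulr_ge0 ?(ltW m0) ?sqr_ge0.
have e1 : 0 < e ^+ 2 / (dot (S y) y + 1) by rewrite divr_gt0 ?exprn_gt0 ?ltr_wpDl.
have /cvgrPdist_lt/(_ _ e1)[N _ NP] := @cvg_harmonic R.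
exists N => // n /= Nn; rewrite -S_self_adjoint -normrN opprB -/(r n y).
rewrite -ler_sqr ?nnegrE ?(ltW e0)// real_normK ?num_real//.
apply: (le_trans (rsmall n y Fy)).
have := NP n Nn; rewrite sub0r normrN ger0_norm ?harmonic_ge0// => h2.
apply: (le_trans (ler_wpM2r q0 (ltW h2))).
by rewrite mulrAC ler_pdivrMr ?ltr_wpDl// ler_wpM2l ?sqr_ge0 ?lerDl.
Qed.

End MinimizationOverSubspace.

(** * Invertibility of strongly monotone self-adjoint maps *)

Section StronglyMonotone.
Variable S : {linear H -> H}.
Hypothesis S_self_adjoint : self_adjoint dot S.
Hypothesis S_strongly_monotone : strongly_monotone dot S.

Lemma strongly_monotone_inj : injective S.
Proof.
have [m m0 mS] := S_strongly_monotone.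
move=> x y Sxy; apply/eqP; rewrite -subr_eq0 -normr_eq0 -sqrf_eq0.
by rewrite eq_le sqr_ge0 andbT -(pmulr_rle0 _ m0) (le_trans (mS _))//
  (linearB S) Sxy subrr linear0l.
Qed.

(** This is surjectivity of [S], so the default value in [inv_map] is never reached: representing
    [dot y] on the whole space solves [S g = y]. *)
Lemma inv_mapK y : S (inv_map S y) = y.
Proof.
apply: (xgetPex 0 (P := [set x | S x = y])).
have [||y0 z|g [_ gP]] := @riesz_subspace S setT (dot y) `|y|
  S_self_adjoint S_strongly_monotone.
- by [].
- by move=> a x z _ _; rewrite !dotE.
- by apply: le_trans (cauchy_schwarz _ _); exact: ler_norm.
exists g; apply/eqP; rewrite -subr_eq0; apply/eqP/(dot_eq0).
by rewrite !(psdDl dotPl) (psdNl dotPl) gP// subrr.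
Qed.

Lemma inv_map_linear a x y :
  inv_map S (a *: x + y) = a *: inv_map S x + inv_map S y.
Proof. by apply: strongly_monotone_inj; rewrite linearP !inv_mapK. Qed.

End StronglyMonotone.

(** * Weak sequential compactness and Opial's lemma *)

(* Along a diagonal subsequence the pairings with each [x m] converge, hence those
   with every vector of the span [F] of [x]; [g] represents the limit functional
   on [F], and a general [y] is replaced by its projection [y'] on the closure. *)
Lemma bounded_weak_cvg_subseq (x : nat -> H) (K : R) :
  (forall n, `|x n| <= K) ->
  exists f : nat -> nat, (forall n, (n <= f n)%N) /\
    exists g, weak_cvg dot (x \o f) g.
Proof.
move=> xK.
have K0 : 0 <= K := le_trans (normr_ge0 _) (xK 0%N).
have [|f [fn fcvg]] := @diagonal_extraction R (fun n m => dot (x n) (x m))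
  (fun m => K * `|x m|).
  by move=> n m; apply: (le_trans (cauchy_schwarz _ _)); rewrite ler_wpM2r.
exists f; split=> //.
(* With the span taken as an intersection of subspaces, a property passes to [F] once it defines a
   subspace containing every [x m]; [Fcvg] uses this. *)
pose F y := forall G : set H, linear_subspace G -> (forall m, G (x m)) -> G y.
have Fx m : F (x m) by move=> G _; apply.
have linF : linear_subspace F.
  split=> [G [G0 _] //|a y z Fy Fz G lG Gx].
  exact: lG.2 (Fy _ lG Gx) (Fz _ lG Gx).
pose a y n := dot (x (f n)) y.
have Fcvg y : F y -> cvgn (a y).
  move=> Fy; apply: (Fy [set z | cvgn (a z)]) => [|m]; last exact: fcvg.
  split=> /=.
    have -> : a 0 = fun=> 0 by apply/funext => n; rewrite /a dot0r.
    exact: is_cvg_cst.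
  move=> c y1 y2 h1 h2.
  have -> : a (c *: y1 + y2) = fun n => c * a y1 n + a y2 n.
    by apply/funext => n; rewrite /a !dotE.
  by apply: is_cvgD => //; apply: is_cvgM => //; exact: is_cvg_cst.
have id_self_adjoint : self_adjoint dot (idfun : H -> H) by [].
have id_strongly_monotone : strongly_monotone dot (idfun : H -> H).
  by exists 1 => // y; rewrite mul1r sqr_norm.
have [c y z Fy Fz|y Fy|g [Fg gP]] := @riesz_subspace idfun F
   (fun y => limn (a y)) K id_self_adjoint id_strongly_monotone linF.
- apply: (cvg_lim (@norm_hausdorff _ _)).
  have -> : a (c *: y + z) = fun n => c * a y n + a z n.
    by apply/funext => n; rewrite /a !dotE.
  by apply: cvgD; [apply: cvgM; [exact: cvg_cst|exact: Fcvg]|exact: Fcvg].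
- apply: limr_le; first exact: Fcvg.
  apply: nearW => n; apply: (le_trans (ler_norm _)).
  by apply: (le_trans (cauchy_schwarz _ _)); rewrite ler_wpM2r.
exists g => y.
have [c z1 z2 _ _|z _|y' [Fy' y'P]] := @riesz_subspace idfun F
   (dot y) `|y| id_self_adjoint id_strongly_monotone linF.
- by rewrite !dotE.
- by apply: le_trans (cauchy_schwarz _ _); exact: ler_norm.
have xy n : dot (x n) y = dot (x n) y' by rewrite !(dotC (x n)) -y'P.
(* [g] is a limit of points of [F], and [y - y'] is orthogonal to [F]. *)
have gy : dot g y = dot g y'.
  apply/eqP; rewrite -subr_eq0 -normr_le0; apply/ler_addgt0Pl => e e0.
  have e1 : 0 < e / (`|y - y'| + 1) by rewrite divr_gt0// ltr_wpDl.
  have [z Fz gz] := Fg _ e1.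
  have -> : dot g y - dot g y' = dot (g - z) (y - y').
    have := y'P z Fz; rewrite !dotE ![dot z _](dotC) => ->; ring.
  rewrite addr0; apply: (le_trans (cauchy_schwarz _ _)).
  apply: (le_trans (ler_wpM2r (normr_ge0 _) (ltW gz))).
  by rewrite -mulrA ler_piMr ?(ltW e0)// ler_pdivrMl ?mulr1 ?lerDl ?ltr_wpDl.
rewrite gy; under eq_fun do rewrite /= xy.
apply/cvgrPdist_lt => e e0.
have e1 : 0 < e / (2 * (`|g| + K + 1)).
  by rewrite divr_gt0// mulr_gt0// ltr_wpDl// addr_ge0.
have [z Fz yz] := Fy' _ e1.
have e2 : 0 < e / 2 by rewrite divr_gt0.
have : a z @ \oo --> dot g z by rewrite gP//; exact: Fcvg.
move=> /cvgrPdist_lt/(_ _ e2); apply: filterS => n nz.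
have -> : dot g y' - dot (x (f n)) y' =
    dot (g - x (f n)) (y' - z) + (dot g z - a z n) by rewrite /a !dotE; ring.
apply: (le_lt_trans (ler_normD _ _)).
rewrite [e]splitr; apply: ler_ltD => //.
apply: (le_trans (cauchy_schwarz _ _)).
have h : `|g - x (f n)| <= `|g| + K by rewrite (le_trans (ler_normB _ _))// lerD.
apply: (le_trans (ler_pM _ _ h (ltW yz))) => //.
have c0 : 0 < `|g| + K + 1 by rewrite ltr_wpDl// addr_ge0.
have -> : (`|g| + K) * (e / (2 * (`|g| + K + 1))) =
    e / 2 * ((`|g| + K) / (`|g| + K + 1)) by field; rewrite gt_eqF.
rewrite ler_piMr ?(ltW e2)//.
by rewrite ler_pdivrMr ?mul1r ?lerDl.
Qed.

(** For weak cluster points [g] and [g'], the limit of [dot (x n) (S (g - g'))] can be computed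
    along either subsequence, so [dot (g - g') (S (g - g')) = 0] and [g = g']. If weak convergence
    to [g] failed, some subsequence would stay away from [g] against a fixed [y], yet it has a
    cluster point too. *)
Lemma opial (S : {linear H -> H}) (Z : set H) (x : nat -> H) (K : R) :
  strongly_monotone dot S ->
  (forall n, `|x n| <= K) ->
  (forall f g, (forall n, (n <= f n)%N) -> weak_cvg dot (x \o f) g -> Z g) ->
  (forall y z, Z y -> Z z -> cvgn (fun n => dot (x n) (S (y - z)))) ->
  exists2 z, Z z & weak_cvg dot x z.
Proof.
move=> [m m0 mS] xK ZP Zcvg.
have [f [fn [g fg]]] := bounded_weak_cvg_subseq xK.
have Zg := ZP _ _ fn fg.
exists g => // y; apply: contrapT => /cvgrPdist_lt.
move=> /existsNP[e /not_implyP[e0 ne]].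
have /choice[h hP] n : exists k, (n <= k)%N /\ e <= `|dot g y - dot (x k) y|.
  apply: contrapT => nk; apply: ne; exists n => // k /= nk'.
  by rewrite ltNge; apply/negP => ek; apply: nk; exists k.
have [f' [fn' [g' fg']]] := @bounded_weak_cvg_subseq (x \o h) K (fun n => xK (h n)).
have hn' n : (n <= h (f' n))%N by apply: leq_trans (fn' n) (hP _).1.
have Zg' := ZP (h \o f') g' hn' fg'.
have gg' : g = g'.
  have /cvg_ex[l ll] := Zcvg _ _ Zg Zg'.
  have l1 := cvg_unique (@norm_hausdorff _ _) (cvg_subseq_ge fn ll) (fg (S (g - g'))).
  have l2 := cvg_unique (@norm_hausdorff _ _) (cvg_subseq_ge hn' ll) (fg' (S (g - g'))).
  apply/eqP; rewrite -subr_eq0 -normr_eq0 -sqrf_eq0.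
  rewrite eq_le sqr_ge0 andbT -(pmulr_rle0 _ m0) (le_trans (mS _))//.
  by rewrite (dotC) !dotE -l1 -l2 subrr.
have /cvgrPdist_lt/(_ e e0)[N _ /(_ N (leqnn N))] := fg' y.
by rewrite /= ltNge -gg' (hP _).2.
Qed.

End RealHilbert.

(** * Scalar energy sequences and convergence rates *)

Lemma lyapunov_cvg {R : realType} (V D : nat -> R) (c : R) : 0 < c ->
  (forall n, 0 <= V n) -> (forall n, 0 <= D n) ->
  (forall n, V n.+1 + c * D n.+1 <= V n) ->
  cvgn V /\ D @ \oo --> 0.
Proof.
move=> c0 V0 D0 VD.
have Vcvg : cvgn V.
  apply: nonincreasing_is_cvgn; last by exists 0 => _ [n _ <-].
  apply/nonincreasing_seqP => n.
  by apply: le_trans (VD n); rewrite lerDl mulr_ge0 ?(ltW c0).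
split=> //.
have VS : (fun n => V n.+1) @ \oo --> limn V.
  by have := Vcvg; rewrite -cvg_shiftS.
have dV : (fun n => c^-1 * (V n - V n.+1)) @ \oo --> 0.
  rewrite -(mulr0 c^-1) -(subrr (limn V)).
  by apply: cvgM; [exact: cvg_cst|exact: cvgB].
rewrite -cvg_shiftS; apply: squeeze_cvgr (cvg_cst 0) dV.
apply: nearW => n; rewrite D0/= mulrC ler_pdivlMr// lerBrDl mulrC.
exact: VD.
Qed.

Lemma cvg0_sqr_norm {R : realType} {H : normedModType R} (q : nat -> H)
    (D : nat -> R) (K : R) :
  (forall n, `|q n| ^+ 2 <= K * D n) -> D @ \oo --> 0 -> q @ \oo --> 0.
Proof.
move=> qD D0; apply/cvgr0Pnorm_lt => e e0.
have KD : (fun n => K * D n) @ \oo --> 0.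
  by rewrite -(mulr0 K); apply: cvgM => //; exact: cvg_cst.
have e2 : 0 < e ^+ 2 by rewrite exprn_gt0.
move: KD => /cvgr0Pnorm_lt/(_ _ e2); apply: filterS => n Dn.
rewrite -ltr_sqr ?nnegrE ?(ltW e0)//.
by apply: (le_lt_trans (qD n)); apply: le_lt_trans Dn; exact: ler_norm.
Qed.

Lemma Rlinear_cvg_geometric {R : realType} {H : completeNormedModType R}
    (x : nat -> H) (l : H) (E q : R) :
  0 <= E -> 0 < q < 1 ->
  (forall n, `|x n.+1 - l| ^+ 2 <= E * q ^+ n) -> Rlinear_cvg x l.
Proof.
move=> E0 /andP[q0 q1] xE.
(* The bound on squares starts at index 1: [E / q] undoes the shift, and the first summand covers
   [n = 0]. *)
pose r := Num.sqrt q; pose c := `|x 0%N - l| + Num.sqrt (E / q).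
have r0 : 0 < r by rewrite sqrtr_gt0.
have r2 : r ^+ 2 = q by rewrite sqr_sqrtr ?ltW.
have c0 : 0 <= c by rewrite addr_ge0 ?sqrtr_ge0.
exists (fun n => c * r ^+ n); split.
- by move=> n; rewrite mulr_ge0// exprn_ge0// ltW.
- exists r; first by rewrite r0 -ltr_sqr ?nnegrE ?(ltW r0)// r2 expr1n.
  by move=> n; rewrite exprS mulrCA normrM (gtr0_norm r0).
case=> [|n]; first by rewrite expr0 mulr1 lerDl sqrtr_ge0.
rewrite -ler_sqr ?nnegrE ?mulr_ge0 ?exprn_ge0 ?(ltW r0)//.
apply: (le_trans (xE n)).
rewrite exprMn -exprM mulnC exprM r2 [q ^+ n.+1]exprS mulrA ler_wpM2r ?exprn_ge0 ?(ltW q0)//.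
rewrite -ler_pdivrMr// -[leLHS]sqr_sqrtr ?divr_ge0 ?(ltW q0)//.
by rewrite ler_sqr ?nnegrE ?sqrtr_ge0// lerDr.
Qed.

(** * The inner product induced by [S] *)

Section ForwardBackward.
Context {R : realType} {H : completeNormedModType R}.
Variable dot : {dot H for idfun}.
Hypothesis Hnorm : hilbert_norm dot.
Variable S : {linear H -> H}.
Hypothesis S_bounded : bounded_op S.
Hypothesis S_self_adjoint : self_adjoint dot S.
Hypothesis S_strongly_monotone : strongly_monotone dot S.

Definition sdot (x y : H) : R := dot x (S y).

Lemma sdotC x y : sdot x y = sdot y x.
Proof. by rewrite /sdot -S_self_adjoint dotC. Qed.

Lemma sdotPl a x y z : sdot (a *: x + y) z = a * sdot x z + sdot y z.
Proof. exact: dotPl. Qed.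

Lemma sdot_ge0 x : 0 <= sdot x x.
Proof.
have [m m0 mS] := S_strongly_monotone.
by rewrite /sdot -S_self_adjoint (le_trans _ (mS x))// mulr_ge0 ?sqr_ge0 ?ltW.
Qed.

Definition sdotE := (psdE sdotC sdotPl).

Lemma sdot_eq0 x : sdot x x = 0 -> x = 0.
Proof.
have [m m0 mS] := S_strongly_monotone => x0.
have := mS x; rewrite S_self_adjoint -/(sdot x x) x0 pmulr_rle0// => h.
by apply/eqP; rewrite -normr_eq0 -sqrf_eq0 eq_le h sqr_ge0.
Qed.

Notation T := (inv_map S).

Lemma dot_sdot x y : dot x y = sdot x (T y).
Proof. by rewrite /sdot (inv_mapK Hnorm S_self_adjoint S_strongly_monotone). Qed.

Lemma sqr_norm_op_inv x : norm_op dot T x ^+ 2 = sdot (T x) (T x).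
Proof. by rewrite /norm_op dotC dot_sdot sqr_sqrtr ?sdot_ge0. Qed.

Let T_linear := inv_map_linear Hnorm S_self_adjoint S_strongly_monotone.

Lemma inv_map0 : T 0 = 0.
Proof. by have := T_linear 1 0 0; rewrite scale1r addr0 scale1r -{1}[T 0]addr0 => /addrI. Qed.

Lemma inv_mapZ a x : T (a *: x) = a *: T x.
Proof. by rewrite -[a *: x]addr0 T_linear inv_map0 addr0. Qed.

Lemma inv_mapD x y : T (x + y) = T x + T y.
Proof. by rewrite -[x]scale1r T_linear !scale1r. Qed.

Lemma inv_mapN x : T (- x) = - T x.
Proof. by rewrite -scaleN1r inv_mapZ scaleN1r. Qed.

Lemma mapK_inv x : T (S x) = x.
Proof.
apply: (strongly_monotone_inj S_strongly_monotone).
by rewrite (inv_mapK Hnorm S_self_adjoint S_strongly_monotone).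
Qed.

Definition inv_mapE := (inv_mapD, inv_mapN, inv_mapZ, mapK_inv).

Lemma lipschitzian_sdot (z : R) (F : H -> H) x y : 0 <= z ->
  lipschitzian dot S z F ->
  sdot (T (F x - F y)) (T (F x - F y)) <= z ^+ 2 * sdot (x - y) (x - y).
Proof.
move=> z0 /(_ x y) h; rewrite -sqr_norm_op_inv.
have -> : sdot (x - y) (x - y) = norm_op dot S (x - y) ^+ 2.
  by rewrite sqr_sqrtr//; exact: sdot_ge0.
by rewrite -exprMn ler_sqr ?nnegrE ?mulr_ge0 ?sqrtr_ge0.
Qed.

Lemma cocoercive_sdot beta C x y : cocoercive dot S beta C ->
  beta * sdot (T (C x - C y)) (T (C x - C y)) <= sdot (x - y) (T (C x - C y)).
Proof. by move=> /(_ x y); rewrite sqr_norm_op_inv dot_sdot. Qed.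

(** Cauchy-Schwarz applied to the right-hand side of cocoercivity, after which one factor [sdot c c]
    cancels. *)
Lemma cocoercive_lipschitz_sdot beta C x y : 0 < beta -> cocoercive dot S beta C ->
  sdot (T (C x - C y)) (T (C x - C y)) <= beta^-1 ^+ 2 * sdot (x - y) (x - y).
Proof.
move=> b0 Cc; have := cocoercive_sdot x y Cc.
set c := T _; set d := x - y => h.
have [c0|c0] := leP (sdot c c) 0.
  by apply: (le_trans c0); rewrite mulr_ge0 ?sqr_ge0 ?sdot_ge0.
have h1 := psd_cauchy_schwarz sdotC sdotPl sdot_ge0 d c.
rewrite exprVn ler_pdivlMl ?exprn_gt0// -(ler_pM2r c0); apply: le_trans h1.
have -> : beta ^+ 2 * sdot c c * sdot c c = (beta * sdot c c) ^+ 2 by ring.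
have bc : 0 <= beta * sdot c c by rewrite mulr_ge0 ?ltW.
by rewrite ler_sqr ?nnegrE// (le_trans bc h).
Qed.

Lemma norm_le_sdot : exists2 K, 0 <= K & forall x, `|x| ^+ 2 <= K * sdot x x.
Proof.
have [m m0 mS] := S_strongly_monotone.
exists m^-1; first by rewrite invr_ge0 ltW.
by move=> x; rewrite ler_pdivlMl// /sdot -S_self_adjoint.
Qed.

Lemma norm_le_sdot_inv :
  exists2 K, 0 <= K & forall x, `|x| ^+ 2 <= K * sdot (T x) (T x).
Proof.
have [m m0 mS] := norm_le_sdot.
have [k kS] := S_bounded.
exists (k ^+ 2 * m); first by rewrite mulr_ge0 ?sqr_ge0.
move=> x; have := kS (T x).
rewrite (inv_mapK Hnorm S_self_adjoint S_strongly_monotone) => h.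
rewrite -mulrA; apply: le_trans (ler_wpM2l (sqr_ge0 k) (mS _)).
by rewrite -exprMn ler_sqr ?nnegrE// (le_trans (normr_ge0 _) h).
Qed.

(* Turns identities between vectors into ring identities between scalars. *)
Lemma sdot_inj x y : (forall v, sdot x v = sdot y v) -> x = y.
Proof.
move=> xy; apply/eqP; rewrite -subr_eq0; apply/eqP.
apply: (sdot_eq0).
by rewrite !(psdDl sdotPl) !(psdNl sdotPl) xy subrr.
Qed.

(** * Energy decrease and convergence of the iteration *)

Section Iteration.
Variables (A : H -> set H) (C M : H -> H) (p u x : nat -> H).
Variables (beta h zeta tau theta zetaM eta lam : R).
Let TMS z := tau *: M z - S z.
Hypothesis beta_gt0 : 0 < beta.
Hypothesis h_le0 : h <= 0.
Hypothesis h_gt : - beta < h.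
Hypothesis zeta_ge0 : 0 <= zeta.
Hypothesis zeta_lt : zeta < 1 / 2.
Hypothesis tau_gt : - zeta * h / (beta + h) < tau.
Hypothesis zetaM_ge0 : 0 <= zetaM.
Hypothesis theta_gt0 : 0 < theta.
Hypothesis theta_lt2 : theta < 2.
Hypothesis C_cocoercive : cocoercive dot S beta C.
Hypothesis M_lipschitz : lipschitzian dot S zetaM M.
Hypothesis TMS_lipschitz : lipschitzian dot S zeta TMS.
Hypothesis eta_ge : forall y z,
  (1 - theta) * sdot (z - y) (T (TMS y - TMS z))
    <= (eta - 1) * zeta * sdot (z - y) (z - y).
Hypothesis p_step : forall n, A (p n.+1) (M (x n) - C (x n) + tau^-1 *: u n - M (p n.+1)).
Hypothesis u_step : forall n, u n.+1 = TMS (p n.+1) - TMS (x n).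
Hypothesis x_step : forall n, x n.+1 = (1 - theta) *: x n + theta *: p n.+1.
Hypothesis lamE : lam =
    2 - theta - 2 * eta * zeta
    - (tau + 2 * h) ^+ 2 / (2 * tau * (beta + h * (1 + tau^-1 * zeta)))
    + 2 * h * tau * ((tau^-1 * zeta + zetaM) ^+ 2 + 4 * (tau^-1 * zeta)).
Hypothesis lam_gt0 : 0 < lam.

Definition residual n : R := sdot (x n - p n.+1) (x n - p n.+1).

(** The [kap] of [lyapunov_step] at [k = - h / tau]: the weight of the previous residual, through
    which [u n.+1] is controlled. *)
Definition memory_weight : R :=
  zeta - 2 * h / tau * zeta * (tau * zetaM + zeta) - 4 * h * zeta.

(* Indexed from the second iterate on: [u 0] is arbitrary, only the later [u n]
   are controlled by the preceding residual. *)
Definition lyapunov (z : H) (n : nat) : R :=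
  sdot (x n.+1 - z) (x n.+1 - z) + 2 * theta * sdot (x n.+1 - z) (T (u n.+1))
  + theta * memory_weight * residual n.

Lemma beta_h_gt0 : 0 < beta + h. Proof. by move: h_gt; lra. Qed.

Lemma tau_gt0 : 0 < tau.
Proof.
apply: le_lt_trans tau_gt; rewrite divr_ge0 ?(ltW beta_h_gt0)//.
by rewrite mulNr oppr_ge0 mulr_ge0_le0.
Qed.

Lemma memory_weight_ge : zeta <= memory_weight.
Proof.
have t0 := tau_gt0; rewrite /memory_weight -addrA lerDl.
have -> : 2 * h / tau * zeta * (tau * zetaM + zeta)
  = 2 * h * (tau^-1 * zeta * (tau * zetaM + zeta)) by ring.
have h1 : 0 <= tau^-1 * zeta * (tau * zetaM + zeta).
  by rewrite !mulr_ge0 ?addr_ge0 ?mulr_ge0 ?invr_ge0 ?(ltW t0).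
have h2 := mulr_le0_ge0 h_le0 h1; have h3 := mulr_le0_ge0 h_le0 zeta_ge0.
by move: h2 h3; lra.
Qed.

Lemma inertia_bound n :
  sdot (T (u n.+1)) (T (u n.+1)) <= zeta ^+ 2 * residual n.
Proof.
rewrite u_step /residual; have := lipschitzian_sdot (p n.+1) (x n) zeta_ge0 TMS_lipschitz.
congr (_ <= _ * _); rewrite -[p n.+1 - x n]opprB.
by rewrite !sdotE; ring.
Qed.

Lemma residual_ge0 n : 0 <= residual n. Proof. exact: sdot_ge0. Qed.

(** Semimonotonicity tested against the single pair [(z, - C z)]. The value [mu = 0] is the
    comonotone case, so one decrease estimate serves both weak and linear convergence. *)
Definition semimonotone_at (mu : R) (z : H) : Prop :=
  forall q a, A q a -> mu * sdot (q - z) (q - z) +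
    h * sdot (T (a + C z)) (T (a + C z)) <= sdot (q - z) (T (a + C z)).

Lemma lyapunov_decrease (mu : R) (z : H) : semimonotone_at mu z ->
  forall n, lyapunov z n.+1 + theta * lam * residual n.+1 +
    2 * theta * tau * mu * sdot (p n.+2 - z) (p n.+2 - z) <= lyapunov z n.
Proof.
move=> Az n; have t0 := tau_gt0.
have tN0 : tau != 0 by rewrite gt_eqF.
pose w := x n.+1 - z; pose d := x n.+1 - p n.+2.
pose c := T (C (x n.+1) - C z); pose v := T (u n.+2); pose u' := T (u n.+1).
pose a := M (x n.+1) - C (x n.+1) + tau^-1 *: u n.+1 - M (p n.+2).
have wd : w - d = p n.+2 - z by apply: sdot_inj => y; rewrite /w /d !sdotE; ring.
have wx : w - theta *: d = x n.+2 - z.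
  by apply: sdot_inj => y; rewrite x_step /w /d !sdotE; ring.
have dv : d - v = T (tau *: M (x n.+1) - tau *: M (p n.+2)).
  apply: sdot_inj => y.
  by rewrite /d /v u_step /TMS !inv_mapE !sdotE; ring.
(* Here [a] is the element of [A (p n.+2)] given by the resolvent step, so the vector in
   [lyapunov_step] is the one tested by [Az]. *)
have ae : d - v + u' - tau *: c = tau *: T (a + C z).
  apply: sdot_inj => y; rewrite dv /c /u' /a !inv_mapE !sdotE.
  by field.
have dE : sdot d d = residual n.+1 by [].
have BE : beta + h * (1 + tau^-1 * zeta) = beta - (- h / tau) * tau - (- h / tau) * zeta.
  by field.
(* Multiplied by [tau], this is exactly the lower bound imposed on [tau]. *)
have B0 : 0 < beta + h * (1 + tau^-1 * zeta).
  rewrite -(pmulr_rgt0 _ t0).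
  have := tau_gt; rewrite ltr_pdivrMr ?beta_h_gt0// => h1.
  have -> : tau * (beta + h * (1 + tau^-1 * zeta)) = tau * (beta + h) + zeta * h by field.
  by move: h1; lra.
have := @lyapunov_step R H sdot sdotC sdotPl sdot_ge0 w d c v u' tau (- h / tau)
  beta zeta zetaM theta mu eta _
  ((tau + 2 * h) ^+ 2 / (2 * tau * (beta + h * (1 + tau^-1 * zeta))))
  (residual n) memory_weight lam t0 _ zeta_ge0 zetaM_ge0
  (ltW theta_gt0) (residual_ge0 n) BE B0.
rewrite wx wd ae dE /lyapunov; apply.
- by rewrite divr_ge0 ?oppr_ge0 ?(ltW t0).
- move: (beta + h * _) B0 => B B0; field.
  by rewrite tN0 gt_eqF.
- exact: inertia_bound.
- exact: inertia_bound.
- rewrite dv -scalerBr (inv_mapZ).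
  rewrite (psdZl sdotPl) (psdZr sdotC sdotPl).
  have := lipschitzian_sdot
    (x n.+1) (p n.+2) zetaM_ge0 M_lipschitz.
  by move=> /(ler_wpM2l (sqr_ge0 tau)); rewrite /residual; lra.
- by rewrite /v u_step; exact: eta_ge.
- exact: cocoercive_sdot.
- rewrite (psdZl sdotPl) !(psdZr sdotC sdotPl).
  have := ler_wpM2l (ltW t0) (Az _ _ (p_step n.+1)).
  rewrite -/a; set e := sdot (T _) _ => h1.
  have -> : - h / tau * (tau * (tau * e)) = - h * tau * e by field.
  by move: h1; lra.
- by rewrite /memory_weight; field.
- by rewrite lamE; move: (_ ^+ 2 / _) => G; field.
Qed.

Lemma theta_zeta_lt1 : 0 < 1 - theta * zeta.
Proof.
have h1 := ler_wpM2r zeta_ge0 (ltW theta_lt2); have h2 := zeta_lt.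
by move: h1 h2; lra.
Qed.

(** Young's inequality splits the cross term into [theta zeta] times [|w|^2] plus the residual; the
    residual half is absorbed because [memory_weight] is at least [zeta]. *)
Lemma lyapunov_ge z n :
  (1 - theta * zeta) * sdot (x n.+1 - z) (x n.+1 - z) <= lyapunov z n.
Proof.
set w := x n.+1 - z.
have ww := sdot_ge0 w; have rr := residual_ge0 n.
have h1 : 2 * sdot (- w) (T (u n.+1)) <= 1 * zeta * (sdot w w + residual n).
  apply: (psd_young sdotC sdotPl sdot_ge0) => //.
  - by rewrite expr1n mul1r (psdNl sdotPl) (psdNr sdotC sdotPl) opprK.
  - exact: inertia_bound.
have h2 : theta * zeta * residual n <= theta * memory_weight * residual n.
  by rewrite ler_wpM2r ?residual_ge0// ler_wpM2l ?memory_weight_ge ?ltW.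
rewrite (psdNl sdotPl) in h1.
have := ler_wpM2l (ltW theta_gt0) h1.
by rewrite /lyapunov -/w; move: h2; lra.
Qed.

Lemma lyapunov_ge0 z n : 0 <= lyapunov z n.
Proof.
by apply: le_trans (lyapunov_ge z n); rewrite mulr_ge0 ?sdot_ge0// ltW// theta_zeta_lt1.
Qed.

Lemma norm_le_lyapunov :
  exists2 K, 0 <= K & forall z n, `|x n.+1 - z| ^+ 2 <= K * lyapunov z n.
Proof.
have [K K0 hK] := norm_le_sdot.
exists (K / (1 - theta * zeta)); first by rewrite divr_ge0// ltW// theta_zeta_lt1.
move=> z n; apply: (le_trans (hK _)).
rewrite -mulrA ler_wpM2l// ler_pdivlMl ?theta_zeta_lt1//; exact: lyapunov_ge.
Qed.

Lemma lyapunov_residual_cvg z : semimonotone_at 0 z ->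
  cvgn (lyapunov z) /\ residual @ \oo --> 0.
Proof.
move=> Az; apply: (@lyapunov_cvg _ _ _ (theta * lam)) => [|n|n|n].
- exact: mulr_gt0.
- exact: lyapunov_ge0.
- exact: residual_ge0.
- by have := lyapunov_decrease Az n; rewrite mulr0 mul0r addr0.
Qed.

Lemma strong_vanishing z : semimonotone_at 0 z ->
  [/\ (fun n => x n - p n.+1) @ \oo --> 0, (fun n => u n.+1) @ \oo --> 0,
    (fun n => M (x n) - M (p n.+1)) @ \oo --> 0 &
    (fun n => C (x n) - C (p n.+1)) @ \oo --> 0].
Proof.
move=> /lyapunov_residual_cvg[_ res0].
have [K K0 hK] := norm_le_sdot.
have [K' K'0 hK'] := norm_le_sdot_inv.
split.
- by apply: (cvg0_sqr_norm (K := K) _ res0) => n; exact: hK.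
- apply: (cvg0_sqr_norm (K := K' * zeta ^+ 2) _ res0) => n.
  by apply: (le_trans (hK' _)); rewrite -mulrA ler_wpM2l// inertia_bound.
- apply: (cvg0_sqr_norm (K := K' * zetaM ^+ 2) _ res0) => n.
  apply: (le_trans (hK' _)); rewrite -mulrA ler_wpM2l//.
  exact: lipschitzian_sdot.
- apply: (cvg0_sqr_norm (K := K' * beta^-1 ^+ 2) _ res0) => n.
  apply: (le_trans (hK' _)); rewrite -mulrA ler_wpM2l//.
  exact: cocoercive_lipschitz_sdot.
Qed.

Lemma weak_cvg_zero (Z := zer (op_add A (single C))) :
  seq_weak_strong_closed dot (gra (op_add A (single C))) ->
  (forall z, Z z -> semimonotone_at 0 z) -> Z !=set0 ->
  exists2 z, Z z & weak_cvg dot x z.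
Proof.
move=> closed AZ [z0 Zz0].
have [xp0 u0 M0 C0] := strong_vanishing (AZ _ Zz0).
have [K K0 hK] := norm_le_lyapunov.
(* The energy controls iterates from index 1 on; the shift is undone at the end. *)
pose y n := x n.+1.
have lya_le n : lyapunov z0 n <= lyapunov z0 0.
  elim: n => // n; apply: le_trans.
  have := lyapunov_decrease (AZ _ Zz0) n; rewrite mulr0 mul0r addr0.
  by apply: le_trans; rewrite lerDl mulr_ge0 ?residual_ge0// mulr_ge0// ltW.
have ybd n : `|y n| <= `|z0| + Num.sqrt (K * lyapunov z0 0).
  rewrite -[y n](subrK z0) addrC (le_trans (ler_normD _ _))// lerD2l.
  rewrite -ler_sqr ?nnegrE ?sqrtr_ge0// sqr_sqrtr ?mulr_ge0 ?lyapunov_ge0//.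
  by apply: (le_trans (hK _ _)); rewrite ler_wpM2l.
have [f g fn fg|z z' Zz Zz'|z Zz yz] :=
  opial Hnorm (S := S) (Z := Z) S_strongly_monotone ybd.
- have [f1 Mf Cf uf] : [/\ (fun n => y (f n) - p (f n).+2) @ \oo --> 0,
      (fun n => M (y (f n)) - M (p (f n).+2)) @ \oo --> 0,
      (fun n => C (y (f n)) - C (p (f n).+2)) @ \oo --> 0 &
      (fun n => u (f n).+1) @ \oo --> 0].
    have fn' n : (n <= (f n).+1)%N by exact: leqW.
    split; [exact: (cvg_subseq_ge fn' xp0)|exact: (cvg_subseq_ge fn' M0)|
      exact: (cvg_subseq_ge fn' C0)|exact: (cvg_subseq_ge fn u0)].
  apply: (closed (fun n => p (f n).+2) (fun n => (M (y (f n)) - M (p (f n).+2))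
     (* These are elements of [(A + C) (p (f n).+2)] tending strongly to 0, while [p (f n).+2] has
        the same weak limit as [y (f n)]. *)
     - (C (y (f n)) - C (p (f n).+2)) + tau^-1 *: u (f n).+1)).
  + move=> n; exists (M (y (f n)) - C (y (f n)) + tau^-1 *: u (f n).+1 - M (p (f n).+2)).
    exists (C (p (f n).+2)); split; first exact: p_step.
    by split=> //=; apply: sdot_inj => v; rewrite !sdotE; ring.
  + have f1w : weak_cvg dot (fun n => y (f n) - p (f n).+2) 0 by exact: cvg_dotl.
    move=> v; rewrite -[dot g v]subr0 -(dot0l dot v).
    have -> : (fun n => dot (p (f n).+2) v) =
        (fun n => dot (y (f n)) v) \- (fun n => dot (y (f n) - p (f n).+2) v).
      by apply/funext => n; rewrite /= !(dotE dot); ring.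
    exact: cvgB (fg v) (f1w v).
  + have h1 : (fun n => tau^-1 *: u (f n).+1) @ \oo --> tau^-1 *: (0 : H).
      by apply: cvgZ => //; exact: cvg_cst.
    by have := cvgD (cvgB Mf Cf) h1; rewrite subr0 scaler0 addr0; apply.
- have [Vz _] := lyapunov_residual_cvg (AZ _ Zz).
  have [Vz' _] := lyapunov_residual_cvg (AZ _ Zz').
  (* In the difference of the energies at two zeros, the terms quadratic in [y n] and the residual
     terms cancel. *)
  have -> : (fun n => dot (y n) (S (z - z'))) = (fun n => 2^-1 *
     (lyapunov z' n - lyapunov z n + (sdot z z - sdot z' z')
      + 2 * theta * dot (u n.+1) (z' - z))).
    apply/funext => n; rewrite /lyapunov -/(sdot (y n) (z - z')) dotC -/(y n).
    by rewrite (dot_sdot) !sdotE !(sdotC _ (y n)); field.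
  have uz : cvgn (fun n => dot (u n.+1) (z' - z)).
    by apply/cvg_ex; exists (dot 0 (z' - z)); exact: (cvg_dotl Hnorm u0).
  apply: is_cvgM; first exact: is_cvg_cst.
  apply: is_cvgD; last by apply: is_cvgM => //; exact: is_cvg_cst.
  by apply: is_cvgD; [exact: is_cvgB|exact: is_cvg_cst].
exists z => // v.
by have := yz v; rewrite -[X in _ -> X]cvg_shiftS.
Qed.

Lemma Rlinear_cvg_zero (mu : R) (z : H) : 0 < mu -> semimonotone_at mu z ->
  Rlinear_cvg x z.
Proof.
move=> mu0 Az; have t0 := tau_gt0.
pose P n := sdot (p n.+2 - z) (p n.+2 - z).
have P0 n : 0 <= P n by exact: sdot_ge0.
have kap0 : 0 <= memory_weight := le_trans zeta_ge0 memory_weight_ge.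
have thz : 0 <= theta * zeta by rewrite mulr_ge0// ltW.
have thk : 0 <= theta * memory_weight by rewrite mulr_ge0// ltW.
(* The sum of the coefficients of [P n] and of the residual obtained by bounding the energy through
   [x n.+2 - z = (p n.+2 - z) + (1 - theta) (x n.+1 - p n.+2)]. *)
pose K := 2 * (1 + theta * zeta) * (1 + (1 - theta) ^+ 2)
  + theta * zeta + theta * memory_weight.
have K0 : 0 < K.
  have h1 : 0 <= theta * zeta * (1 - theta) ^+ 2 by rewrite mulr_ge0 ?sqr_ge0.
  by have h2 := sqr_ge0 (1 - theta); rewrite /K; move: h1 h2 thz thk; lra.
have sqrD (y y' : H) (t : R) : sdot (y + t *: y') (y + t *: y')
    <= 2 * sdot y y + 2 * t ^+ 2 * sdot y' y'.
  by have := sdot_ge0 (y - t *: y'); rewrite !sdotE (sdotC y' y); lra.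
have VK n : lyapunov z n.+1 <= K * (P n + residual n.+1).
  set w := x n.+2 - z; set d := x n.+1 - p n.+2; set q := p n.+2 - z.
  have wE : w = q + (1 - theta) *: d.
    by apply: sdot_inj => y; rewrite /w /q /d x_step !sdotE; ring.
  have h1 : sdot w w <= 2 * sdot q q + 2 * (1 - theta) ^+ 2 * sdot d d.
    by rewrite wE.
  have ww := sdot_ge0 w; have rr := residual_ge0 n.+1.
  have h2 : 2 * sdot w (T (u n.+2)) <= 1 * zeta * (sdot w w + residual n.+1).
    apply: (psd_young sdotC sdotPl sdot_ge0); rewrite ?expr1n ?mul1r ?ler01//.
    exact: inertia_bound.
  have h3 := ler_wpM2l (ltW theta_gt0) h2.
  have tz1 : 0 <= 1 + theta * zeta by rewrite addr_ge0.
  have h4 := ler_wpM2l tz1 h1.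
  have h5 : 0 <= (2 * (1 + theta * zeta) * (1 - theta) ^+ 2
       + theta * zeta + theta * memory_weight) * P n.
    by rewrite mulr_ge0// addr_ge0// addr_ge0// mulr_ge0 ?sqr_ge0// mulr_ge0.
  have h6 : 0 <= 2 * (1 + theta * zeta) * residual n.+1.
    by rewrite mulr_ge0 ?residual_ge0// mulr_ge0.
  rewrite /lyapunov -/w /K /P -/q; rewrite /P -/q in h5.
  move: h3 h4 h5 h6; rewrite /residual -/d; lra.
pose c := Num.min (theta * lam) (2 * theta * tau * mu).
have c0 : 0 < c by rewrite lt_min !mulr_gt0.
have Kc : 0 < K + c by exact: addr_gt0.
(* The decrease is at least [c (P n + residual n.+1)], and by [VK] this is at least [c / K] times
   the new energy. *)
have Vc n : lyapunov z n.+1 <= K / (K + c) * lyapunov z n.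
  have h1 : c * (P n + residual n.+1) <= lyapunov z n - lyapunov z n.+1.
    have h2 : c * residual n.+1 <= theta * lam * residual n.+1.
      by rewrite ler_wpM2r ?residual_ge0// ge_min lexx.
    have h3 : c * P n <= 2 * theta * tau * mu * P n.
      by rewrite ler_wpM2r// ge_min lexx orbT.
    by have := lyapunov_decrease Az n; rewrite -/(P n); move: h2 h3; lra.
  rewrite mulrAC ler_pdivlMr//.
  have h2 := ler_wpM2l (ltW c0) (VK n); have h3 := ler_wpM2l (ltW K0) h1.
  by move: h2 h3; lra.
have q01 : 0 < K / (K + c) < 1.
  by apply/andP; split; [exact: divr_gt0|rewrite ltr_pdivrMr// mul1r ltrDl].
have [E E0 hE] := norm_le_lyapunov.
have V0 := lyapunov_ge0 z 0.
have /andP[q0 _] := q01.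
apply: (Rlinear_cvg_geometric (mulr_ge0 E0 V0) q01) => n.
apply: (le_trans (hE _ _)); rewrite -mulrA ler_wpM2l//.
elim: n => [|n IH]; first by rewrite mulr1.
by apply: (le_trans (Vc n)); rewrite exprS mulrCA ler_wpM2l// ltW.
Qed.

End Iteration.

(** * From the standing assumptions to the hypotheses of the iteration *)

Lemma semimonotone_at_zero (A : H -> set H) (C : H -> H) (mu rho h : R) (z : H) :
  h <= rho ->
  semimonotone dot (fun y => mu *: S y) (fun v => rho *: T v)
    [set xv | zer (op_add A (single C)) xv.1 /\ xv.2 = - C xv.1] A ->
  zer (op_add A (single C)) z -> semimonotone_at A C h mu z.
Proof.
move=> hrho Amono Zz q a Aqa.
have := Amono (z, - C z) (q, a) (conj Zz erefl) Aqa; rewrite /= opprK.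
have -> : dot (q - z) (mu *: S (q - z)) = mu * sdot (q - z) (q - z).
  exact: (psdZr (dotC dot) (dotPl dot)).
rewrite (psdZr (dotC dot) (dotPl dot)) [dot _ (T _)]dotC !dot_sdot.
by apply: le_trans; rewrite lerD2l ler_wpM2r ?sdot_ge0.
Qed.

(** Testing [- C z'] in [A z'] against [z] and adding cocoercivity gives [mu |z' - z|^2 + (beta + h)
    |T (C z' - C z)|^2 <= 0]. *)
Lemma zer_unique (A : H -> set H) (C : H -> H) (beta mu h : R) (z z' : H) :
  cocoercive dot S beta C -> - beta < h -> 0 < mu ->
  semimonotone_at A C h mu z -> zer (op_add A (single C)) z' -> z' = z.
Proof.
move=> Cc hb mu0 Az [a [c [Aa [-> ac]]]].
have := Az z' a Aa.
have -> : a + C z = - (C z' - C z).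
  by rewrite opprB addrC; congr (_ + _); apply/eqP; rewrite -addr_eq0 -ac.
have := cocoercive_sdot z' z Cc.
rewrite inv_mapN !(psdNl sdotPl) !(psdNr sdotC sdotPl) opprK => h1 h2.
have h3 : 0 <= (beta + h) * sdot (T (C z' - C z)) (T (C z' - C z)).
  by rewrite mulr_ge0 ?sdot_ge0//; move: hb; lra.
apply/eqP; rewrite -subr_eq0; apply/eqP/sdot_eq0/le_anti.
by rewrite sdot_ge0 andbT -(pmulr_rle0 _ mu0); move: h1 h2 h3; lra.
Qed.

(** If [eta = 1] the right side vanishes, and on the left [1 - theta <= 0] multiplies a pairing that
    is nonnegative by monotonicity of [S - tau M]. Otherwise [eta - 1] is the absolute value of
    [1 - theta], and the Lipschitz bound controls the pairing. *)
Lemma relax_eta_bound (M : H -> H) (tau theta zeta : R) (y z : H)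
    (TMS := fun y : H => tau *: M y - S y) :
  0 <= zeta -> lipschitzian dot S zeta TMS ->
  (1 - theta) * sdot (z - y) (T (TMS y - TMS z))
    <= (relax_eta dot S M tau theta - 1) * zeta * sdot (z - y) (z - y).
Proof.
move=> zeta0 lip; rewrite /relax_eta; case: asboolP => [[/andP[th1 _] mono]|_].
  rewrite subrr !mul0r mulr_le0_ge0 ?subr_le0// -dot_sdot.
  by have := mono z y; rewrite /TMS; congr (_ <= dot _ _);
    apply: sdot_inj => v; rewrite !sdotE; ring.
have Tle : sdot (T (TMS y - TMS z)) (T (TMS y - TMS z)) <= zeta ^+ 2 * sdot (z - y) (z - y).
  have := lipschitzian_sdot y z zeta0 lip.
  by congr (_ <= _ * _); rewrite !sdotE; ring.
set d := z - y in Tle *; set v := T _ in Tle *.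
have dd := sdot_ge0 d.
have one_d : sdot d d <= 1 ^+ 2 * sdot d d by rewrite expr1n mul1r.
have vd : 2 * sdot v d <= zeta * 1 * (sdot d d + sdot d d).
  exact: (psd_young sdotC sdotPl sdot_ge0).
have Nvd : 2 * sdot (- v) d <= zeta * 1 * (sdot d d + sdot d d).
  apply: (psd_young sdotC sdotPl sdot_ge0) => //.
  by rewrite (psdNl sdotPl) (psdNr sdotC sdotPl) opprK.
rewrite (psdNl sdotPl) in Nvd.
have abs_le : `|sdot d v| <= zeta * sdot d d.
  by rewrite ler_norml (sdotC d v); move: vd Nvd; lra.
apply: (le_trans (ler_norm _)); rewrite normrM.
by rewrite addrAC subrr add0r -mulrA ler_wpM2l.
Qed.

End ForwardBackward.

(** * Assembly of weak and linear convergence *)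

Unset Implicit Arguments.
Set Strict Implicit.
Set Printing Implicit Defensive.

Theorem theorem3p10 (R : realType) (H : completeNormedModType R)
    (dot : {dot H for idfun}) (Hnorm : hilbert_norm dot)
    (S : {linear H -> H}) (A : H -> set H) (C M : H -> H)
    (beta rho zeta tau theta zetaM : R)
    (S_bounded : bounded_op S)
    (S_self_adjoint : self_adjoint dot S)
    (S_strongly_monotone : strongly_monotone dot S)
    (beta_gt0 : 0 < beta)
    (C_cocoercive : cocoercive dot S beta C)
    (resolvent : single_valued_full_domain (op_inv (op_add (single M) A)))
    (AC_closed : seq_weak_strong_closed dot (gra (op_add A (single C))))
    (rho_gt : - beta < rho) :
  let SS := [set xv : H * H |
    zer (op_add A (single C)) xv.1 /\ xv.2 = - C xv.1] in
  let rhohat := Num.min rho 0 in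
  let TMS := fun z : H => tau *: M z - S z in
  let eta := relax_eta dot S M tau theta in
  let lambda :=
    2 - theta - 2 * eta * zeta
    - (tau + 2 * rhohat) ^+ 2
        / (2 * tau * (beta + rhohat * (1 + tau^-1 * zeta)))
    + 2 * rhohat * tau
        * ((tau^-1 * zeta + zetaM) ^+ 2 + 4 * (tau^-1 * zeta)) in
  forall
    (A_comonotone : comonotone dot (fun v => rho *: inv_map S v) SS A)
    (zeta_range : 0 <= zeta < 1 / 2)
    (tau_gt : - zeta * rhohat / (beta + rhohat) < tau)
    (TMS_lipschitz : lipschitzian dot S zeta TMS)
    (zer_nonempty : zer (op_add A (single C)) !=set0)
    (theta_range : 0 < theta < 2)
    (p u x : nat -> H)
    (p_step : forall n : nat,
       op_inv (op_add (single M) A) (M (x n) - C (x n) + tau^-1 *: u n)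
         = [set p n.+1])
    (u_step : forall n : nat, u n.+1 = TMS (p n.+1) - TMS (x n))
    (x_step : forall n : nat,
       x n.+1 = (1 - theta) *: x n + theta *: p n.+1)
    (zetaM_gt0 : 0 < zetaM)
    (zetaM_modulus : lipschitz_modulus dot S M zetaM)
    (lambda_gt0 : 0 < lambda),
  (exists2 z : H, zer (op_add A (single C)) z & weak_cvg dot x z)
  /\
  (forall mu : R, 0 < mu ->
     semimonotone dot (fun y => mu *: S y) (fun v => rho *: inv_map S v) SS A ->
     exists2 z : H, zer (op_add A (single C)) = [set z] & Rlinear_cvg x z).
Proof.
move=> SS rhohat TMS eta lambda Aco /andP[zeta0 zeta1] tau_gt lip Zne
  /andP[theta0 theta2] p u x p_step u_step x_step zM0 [[_ Mlip] _] lam0.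
have h0 : rhohat <= 0 by rewrite ge_min lexx orbT.
have hrho : rhohat <= rho by rewrite ge_min lexx.
have hgt : - beta < rhohat by rewrite lt_min rho_gt oppr_lt0.
have eta_ge y z := relax_eta_bound Hnorm S_self_adjoint S_strongly_monotone
  theta y z zeta0 lip.
have p_step' n : A (p n.+1) (M (x n) - C (x n) + tau^-1 *: u n - M (p n.+1)).
  have : [set p n.+1] (p n.+1) by [].
  by rewrite -p_step => -[_ [v [-> [Av ->]]]]; rewrite addrC addKr.
split.
  apply: (weak_cvg_zero Hnorm S_bounded S_self_adjoint S_strongly_monotone
    beta_gt0 h0 hgt zeta0 zeta1 tau_gt (ltW zM0) theta0 theta2 C_cocoercive Mlip
    lip eta_ge p_step' u_step x_step erefl lam0 AC_closed _ Zne) => z Zz.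
  apply: (semimonotone_at_zero Hnorm S_self_adjoint S_strongly_monotone hrho _ Zz).
  (* Comonotonicity is read as semimonotonicity with [mu = 0]. *)
  suff -> : (fun y => 0 *: S y) = fun=> 0 by [].
  by apply/funext => y; rewrite scale0r.
move=> mu mu0 Amono; have [z Zz] := Zne.
have Az := semimonotone_at_zero Hnorm S_self_adjoint S_strongly_monotone hrho Amono Zz.
exists z.
  apply/seteqP; split=> [z' Zz'|_ ->//].
  exact: (zer_unique Hnorm S_self_adjoint S_strongly_monotone C_cocoercive hgt mu0 Az Zz').
exact: (Rlinear_cvg_zero Hnorm S_self_adjoint S_strongly_monotone
    h0 hgt zeta0 zeta1 tau_gt (ltW zM0) theta0 theta2 C_cocoercive Mlip
    lip eta_ge p_step' u_step x_step erefl lam0 mu0 Az).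
Qed.
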